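(* For every polynomial $F = Z^n + c_1 Z^{n-1} + \dots + c_{n-1} Z + c_n$ with complex coefficients $c_1,\dots,c_n \in \mathbb{C}$ there exist $z_1,z_2,\dots,z_n \in \mathbb{C}$ such that $F = (Z-z_1)(Z-z_2)\cdots(Z-z_n)$.
   Context: $\mathbb{C}$ is the field of complex numbers and $F$ is a monic polynomial of degree $n$ in $\mathbb{C}[Z]$. *)

(* Defs.v *)
From mathcomp Require Import all_boot all_algebra.
From mathcomp Require Import reals.
From mathcomp.real_closed Require Import complex.

(* Main.v *)
Require Import Defs.
From mathcomp Require Import all_boot all_algebra.
From mathcomp Require Import reals.
From mathcomp.real_closed Require Import complex.
Import GRing.Theory.
Local Open Scope ring_scope.
Local Open Scope complex_scope.

(** Over an algebraically closed field a monic polynomial is the product of ['X - z] over its roots,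
    as many as its degree ([monic_closed_field_prod]). Here the lower terms have size at most [n],
    so the sum is monic of degree exactly [n]. *)

Lemma size_sum_lower_terms (A : nzRingType) (n : nat) (c : 'I_n -> A) :
  (size (\sum_(i < n) c i *: 'X^(n - i.+1))%R <= n)%N.
Proof.
apply: leq_trans (size_sum _ _ _) _; apply/bigmax_leqP => i _.
apply: leq_trans (size_scale_leq _ _) _.
by rewrite size_polyXn subnSK // leq_subr.
Qed.

Lemma monic_closed_field_prod (F : closedFieldType) (p : {poly F}) :
  p \is monic ->
  exists z : 'I_(size p).-1 -> F, p = \prod_i ('X - (z i)%:P).
Proof.
move=> /monicP p_monic; have [rs] := closed_field_poly_normal p.
(* Once the product over [rs] replaces [p], the index type is ['I_(size rs)]. *)
rewrite p_monic scale1r => ->; rewrite size_prod_XsubC /=.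
by exists (fun i => rs`_i); rewrite (big_nth 0) big_mkord.
Qed.

(* The ordinal i : 'I_n carries the coefficient c_(i+1) and the root z_(i+1). *)
Theorem theorem1p1 (R : realType) (n : nat) (c : 'I_n -> R[i]) :
  exists z : 'I_n -> R[i],
    'X^n + \sum_(i < n) c i *: 'X^(n - i.+1) = \prod_(i < n) ('X - (z i)%:P).
Proof.
set p := 'X^n + _.
have lt_size : (size (\sum_(i < n) c i *: 'X^(n - i.+1))%R < size ('X^n : {poly R[i]}))%N.
  by rewrite size_polyXn ltnS size_sum_lower_terms.
have p_monic : p \is monic by rewrite monicE lead_coefDl // lead_coefXn.
(* Algebraic closedness enters only through the canonical [closedFieldType] structure that real-closed puts on [R[i]]. *)
have := @monic_closed_field_prod R[i] p p_monic.
(* By [lt_size], [p] has size [n.+1], which turns ['I_(size p).-1] into ['I_n]. *)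
by rewrite size_polyDl // size_polyXn.
Qed.
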